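(* There is a Borel map $\varphi\colon \mathrm{K}^*\to\mathrm{SF}$ such that $\varphi(A)$ is isomorphic to $\lambda_0(A)$ for all $A\in\mathrm{K}^*$.
   Context: $\mathbb{N}=\{1,2,\dots\}$. A Köthe matrix is an $\mathbb{N}$-by-$\mathbb{N}$ matrix $A=[a_{i,k}]_{(i,k)\in\mathbb{N}\times\mathbb{N}}$ of strictly positive reals with $a_{i,k}\le a_{i,k+1}$ for all $i,k\in\mathbb{N}$. Let $\mathrm{K}=\{[a_{i,k}]\in\mathbb{N}^{\mathbb{N}\times\mathbb{N}}\mid [a_{i,k}]\text{ is a Köthe matrix}\}$ and $$\mathrm{K}^*=\{[a_{i,k}]\in\mathrm{K}\mid \forall i\in\mathbb{N},\ \forall k\ge i,\ a_{i,k}=a_{i,i}\},$$ with the topology inherited from the product topology of $\mathbb{N}^{\mathbb{N}\times\mathbb{N}}$ ($\mathbb{N}$ discrete); $\mathrm{K}^*$ is a Polish space. For a Köthe matrix $A=[a_{i,k}]$ and $k\in\mathbb{N}$, let $\|(x_i)_i\|_k=\sup_{i}|x_ia_{i,k}|$ on the space $c_{00}$ of finitely supported real sequences, and let $\lambda(A,k)$ be the Banach space completion of $(c_{00},\|\cdot\|_k)$, identified with a vector subspace of $\mathbb{R}^{\mathbb{N}}$ (namely the sequences with $x_ia_{i,k}\to0$ as $i\to\infty$). Then $\lambda_0(A)=\bigcap_{k}\lambda(A,k)$, with the Fréchet space topology induced by the diagonal embedding $\lambda_0(A)\to\prod_k\lambda(A,k)$, i.e., generated by the norms $(\|\cdot\|_k)_k$.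 $C(\mathbb{R})$ is the Fréchet space of continuous real-valued functions on $\mathbb{R}$ with the topology of uniform convergence on compact sets. $\mathrm{SF}=\{X\subseteq C(\mathbb{R})\mid X\text{ is a closed vector subspace}\}$ with the Effros Borel structure, i.e., the $\sigma$-algebra generated by the sets $\{X\in\mathrm{SF}\mid X\cap U\neq\emptyset\}$, $U\subseteq C(\mathbb{R})$ open; it is a standard Borel space. Isomorphic means linearly homeomorphic. *)

(* Defs.v *)
From HB Require Import structures.
From mathcomp Require Import all_boot all_order all_algebra.
From mathcomp Require Import all_classical all_reals all_analysis.

(* Rows and columns of matrices, and terms of sequences, are numbered from 0
   instead of 1. *)

Set Implicit Arguments.
Unset Strict Implicit.
Unset Printing Implicit Defensive.

Import Order.TTheory GRing.Theory Num.Theory.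
Import numFieldNormedType.Exports.

Local Open Scope classical_set_scope.
Local Open Scope ring_scope.

Definition isomorphic (R : numDomainType) (E F : preTopologicalLmodType R) :=
  exists (f : {linear E -> F}) (g : F -> E),
    [/\ cancel f g, cancel g f, continuous f & continuous g].

Section KotheMatrices.
Context (R : realType).

Definition is_kothe : set (nat * nat -> R) :=
  [set A | forall i k, 0 < A (i, k) <= A (i, k.+1)].

Definition kothe : Type := set_type is_kothe.

(* Positivity in [is_kothe] makes the entries range over {1, 2, ...}. *)
Definition kothe_nat : set {ptws nat * nat -> nat} :=
  [set a | is_kothe (fun p => (a p)%:R)].

Definition kothe_star : set {ptws nat * nat -> nat} :=
  [set a | kothe_nat a /\
    forall i k : nat, (i <= k)%N -> a (i, k) = a (i, i)].

Definition Kstar : Type := set_type kothe_star.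

HB.instance Definition _ := Topological.on Kstar.

Lemma kothe_star1 : (fun=> 1%N) \in kothe_star.
Proof. by rewrite inE; split => // i k /=; rewrite ltr01 lexx. Qed.

HB.instance Definition _ := isPointed.Build Kstar (SigSub kothe_star1).

Definition Kstar_borel := g_sigma_algebraType (@open Kstar).

Lemma Kstar_is_kothe (a : Kstar) : (fun p => (val a p)%:R) \in is_kothe.
Proof. by rewrite inE; have /set_mem[] := valP a. Qed.

Definition kothe_of (a : Kstar) : kothe := SigSub (Kstar_is_kothe a).

End KotheMatrices.

Section KotheSpaces.
Context (R : realType) (A : kothe R).
Implicit Types (x y : nat -> R) (k : nat).

Lemma kothe_gt0 i k : 0 < val A (i, k).
Proof. by have /set_mem/(_ i k)/andP[] := valP A. Qed.

(* The completion of the finitely supported sequences under the k-th norm,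
   realised as a space of sequences; the norm is [lambda_norm]. *)
Definition lambda_set k : set (nat -> R) :=
  [set x | (fun i => x i * val A (i, k)) @ \oo --> (0 : R)].

Definition lambda_pred k : {pred (nat -> R)} := fun x => x \in lambda_set k.

Lemma lambda_submod k : submod_closed (lambda_pred k).
Proof.
split; first by apply/mem_set; rewrite /lambda_set/=; under eq_fun do rewrite mul0r; exact: cvg_cst.
move=> c x y /set_mem cx /set_mem cy; apply/mem_set; rewrite /lambda_set/=.
rewrite (_ : (fun i => _) = (fun i => c * (x i * val A (i, k)) +
  y i * val A (i, k))); last first.
  by apply/funext => i /=; rewrite mulrDl mulrA.
by rewrite -[0](addr0 (0 : R)) -[X in X + _](mulr0 c); apply: cvgD => //; apply: cvgMr.
Qed.

HB.instance Definition _ k :=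
  GRing.isSubmodClosed.Build R (nat -> R) (lambda_pred k) (lambda_submod k).

Definition lambda k : Type := {x : nat -> R | lambda_pred k x}.
HB.instance Definition _ k := SubChoice.on (lambda k).
HB.instance Definition _ k := [SubChoice_isSubLmodule of lambda k by <:].

Definition lambda_norm k (x : lambda k) : R :=
  sup (range (fun i => `|val x i * val A (i, k)|)).

Lemma lambda_has_sup k (x : lambda k) :
  has_sup (range (fun i => `|val x i * val A (i, k)|)).
Proof.
split; first by exists `|val x 0 * val A (0, k)|; exists 0%N.
have /set_mem cx := valP x.
have /cvg_seq_bounded/pinfty_ex_gt0[M M0 HM] : cvgn (fun i => val x i * val A (i, k)).
  by apply/cvg_ex; exists 0.
by exists M => _ [i _ <-]; apply: HM.
Qed.

Lemma lambda_norm_ub k (x : lambda k) i :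
  `|val x i * val A (i, k)| <= lambda_norm x.
Proof. by apply: sup_upper_bound; [exact: lambda_has_sup|exists i]. Qed.

Lemma lambda_norm_le k (x : lambda k) (M : R) :
  (forall i, `|val x i * val A (i, k)| <= M) -> lambda_norm x <= M.
Proof.
move=> h; apply: ge_sup; last by move=> _ [i _ <-].
by have [] := lambda_has_sup x.
Qed.

Lemma lambda_normD k (x y : lambda k) :
  lambda_norm (x + y) <= lambda_norm x + lambda_norm y.
Proof.
apply: lambda_norm_le => i.
rewrite [val (x + y)]raddfD /= mulrDl (le_trans (ler_normD _ _))//.
by rewrite lerD// lambda_norm_ub.
Qed.

Lemma lambda_normZ k (c : R) (x : lambda k) :
  lambda_norm (c *: x) = `|c| * lambda_norm x.
Proof.
have le (b : R) (y : lambda k) : lambda_norm (b *: y) <= `|b| * lambda_norm y.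
  apply: lambda_norm_le => i.
  by rewrite linearZ /= -[(_ *: _) i]/(b * _) -mulrA normrM ler_wpM2l// lambda_norm_ub.
apply/eqP; rewrite eq_le le /=; have [->|c0] := eqVneq c 0.
  by rewrite normr0 mul0r (le_trans _ (lambda_norm_ub _ 0)).
rewrite -ler_pdivlMl ?normr_gt0// -normfV.
by have := le c^-1 (c *: x); rewrite scalerA mulVf// scale1r.
Qed.

Lemma lambda_norm0_eq0 k (x : lambda k) : lambda_norm x = 0 -> x = 0.
Proof.
move=> x0; apply/val_inj/funext => i.
have := lambda_norm_ub x i; rewrite x0 normr_le0 mulf_eq0 => /orP[/eqP//|].
by rewrite gt_eqF// kothe_gt0.
Qed.

HB.instance Definition _ k := Lmodule_isNormed.Build R (lambda k)
  (@lambda_normD k) (@lambda_normZ k) (@lambda_norm0_eq0 k).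

Definition lambda0_pred : {pred (nat -> R)} :=
  fun x => x \in \bigcap_k lambda_set k.

Lemma lambda0_submod : submod_closed lambda0_pred.
Proof.
split; first by apply/mem_set => k _; apply/set_mem/(rpred0 (lambda_pred k)).
move=> c x y /set_mem hx /set_mem hy; apply/mem_set => k _; apply/set_mem.
by apply: (proj2 (lambda_submod k) c); apply/mem_set; [exact: hx|exact: hy].
Qed.

HB.instance Definition _ :=
  GRing.isSubmodClosed.Build R (nat -> R) lambda0_pred lambda0_submod.

Definition lambda0 : Type := {x : nat -> R | lambda0_pred x}.
HB.instance Definition _ := SubChoice.on lambda0.
HB.instance Definition _ := [SubChoice_isSubLmodule of lambda0 by <:].

Lemma lambda0_lambda (x : lambda0) k : lambda_pred k (val x).
Proof. by apply/mem_set; have /set_mem := valP x; exact. Qed.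

(* The diagonal embedding into the product of the normed spaces [lambda k]. *)
Definition lambda0_diag (x : lambda0) :
    prod_topology (fun k => lambda k : topologicalType) :=
  fun k => exist _ (val x) (lambda0_lambda x k).

HB.instance Definition _ :=
  Topological.copy lambda0 (initial_topology lambda0_diag).

End KotheSpaces.

Section ContinuousFunctions.
Context (R : realType).

Definition CR : Type := continuousType R R.

HB.instance Definition _ := Choice.on CR.

Definition CR_pred : {pred (R -> R)} := fun f => `[< continuous f >].

Definition CR_val (f : CR) : R -> R := f.

Definition CR_Sub (f : R -> R) (cf : CR_pred f) : CR := mkcts (asboolW cf).

Lemma CR_rect (K : CR -> Type) :
  (forall f cf, K (@CR_Sub f cf)) -> forall u, K u.
Proof.
move=> h u; have cu : CR_pred (CR_val u) by apply/asboolP; exact: cts_fun.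
by rewrite (_ : u = CR_Sub cu)//; apply/continuousEP.
Qed.

Lemma CR_SubK f (cf : CR_pred f) : CR_val (CR_Sub cf) = f.
Proof. by []. Qed.

HB.instance Definition _ := isSub.Build (R -> R) CR_pred CR CR_rect CR_SubK.

Lemma CR_submod : submod_closed CR_pred.
Proof.
split; first by apply/asboolP => x; exact: cvg_cst.
move=> c f g /asboolP cf /asboolP cg; apply/asboolP => x.
by apply: cvgD; [apply: cvgMr; exact: cf|exact: cg].
Qed.

HB.instance Definition _ :=
  GRing.isSubmodClosed.Build R (R -> R) CR_pred CR_submod.
HB.instance Definition _ := [SubChoice_isSubLmodule of CR by <:].

HB.instance Definition _ := Topological.copy CR
  (initial_topology (CR_val : CR -> {family compact, R -> R})).

Definition closed_subspace : set (set CR) :=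
  [set X | closed X /\ submod_closed (mem X)].

Definition SF : Type := set_type closed_subspace.

HB.instance Definition _ := Choice.on SF.

Lemma closed_subspaceT : setT \in closed_subspace.
Proof.
rewrite inE; split; first exact: closedT.
by split => [|c f g _ _]; rewrite in_setE.
Qed.

HB.instance Definition _ := isPointed.Build SF (SigSub closed_subspaceT).

Definition effros_generators : set (set SF) :=
  [set [set X : SF | val X `&` U !=set0] | U in @open CR].

Definition SF_effros := g_sigma_algebraType effros_generators.

Definition SF_pred (X : SF) : {pred CR} := fun f => f \in val X.

Lemma SF_submod (X : SF) : submod_closed (SF_pred X).
Proof. by have /set_mem[] := valP X. Qed.

HB.instance Definition _ (X : SF) :=
  GRing.isSubmodClosed.Build R CR (SF_pred X) (SF_submod X).

Definition SF_type (X : SF) : Type := {f : CR | SF_pred X f}.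
HB.instance Definition _ (X : SF) := SubChoice.on (SF_type X).
HB.instance Definition _ (X : SF) := [SubChoice_isSubLmodule of SF_type X by <:].
HB.instance Definition _ (X : SF) :=
  Topological.copy (SF_type X) (initial_topology (val : SF_type X -> CR)).

End ContinuousFunctions.

(* Main.v *)
Require Import Defs.
From HB Require Import structures.
From mathcomp Require Import all_boot all_order all_algebra.
From mathcomp Require Import all_classical all_reals all_analysis.
From mathcomp Require Import ring lra.

Set Implicit Arguments.
Unset Strict Implicit.
Unset Printing Implicit Defensive.

Import Order.TTheory GRing.Theory Num.Theory.
Import numFieldNormedType.Exports.

Local Open Scope classical_set_scope.
Local Open Scope ring_scope.

(** The space lambda_0(A) is copied into C(R) by drawing, for each row i and
    each column k, a hat of height [x i * A (i, k)] inside ]k, k + 1[, the hats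
    of column k being pairwise disjoint and accumulating at the point k only
    (row i peaks at k + 2^-(i+1)).  The sum [embed x] of these hats is
    continuous at k precisely because [x i * A (i, k)] tends to 0 as i grows,
    and, the hats being disjoint, its supremum over ]k, k + 1[ is the k-th norm
    of x; as the norms increase with k, uniform convergence on compact sets
    pulls back to the topology of lambda_0(A).

    The copy [glued_SF A] is closed because it is cut out by pointwise
    conditions: f belongs to it iff, at every t, f equals the sum of hats whose
    coefficients are read off from the values of f at the peaks of column 0
    ([glued_closed]).  Such an f does come from lambda_0(A): its values at the
    peaks of column k tend to f(k) by continuity, and f(k) = 0 as no hat meets
    an integer ([coords_lambda0]).  This gives the isomorphism
    ([glued_isomorphic]).

    The map sending A to its copy is Borel because each generator of the Effros
    structure pulls back to an open set ([glued_meets_open]).  If an f in the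
    copy of A lies in an open set U, then on [-m, m] the function f is close to
    the finite sum of hats given by its first N coordinates, for suitable m and
    N.  On [-m, m] this sum involves only the entries of A with i < N and
    k < m, so the same coordinates yield a function of U in the copy of every B
    that agrees with A on these finitely many natural numbers. *)

(** * Disjoint hats and their sums *)

Section Hats.
Context (R : realType).
Implicit Types (n : nat * nat) (t : R) (y : nat * nat -> R).

Definition peak n : R := n.2%:R + 2 ^- n.1.+1.

Definition hat n t : R :=
  Num.max 0 (1 - 3 * `|2 ^+ n.1.+1 * (t - n.2%:R) - 1|).

Lemma hat_ge0 n t : 0 <= hat n t.
Proof. by rewrite le_max lexx. Qed.

Lemma hat_le1 n t : hat n t <= 1.
Proof.
rewrite ge_max ler01 /=.
by have := normr_ge0 (2 ^+ n.1.+1 * (t - n.2%:R) - 1); lra.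
Qed.

Lemma hat_peak n : hat n (peak n) = 1.
Proof.
rewrite /hat /peak addrAC subrr add0r divff ?expf_neq0//.
by rewrite subrr normr0 mulr0 subr0; apply/max_idPr.
Qed.

Lemma hat_continuous n : continuous (hat n).
Proof.
move=> t; apply: (@continuous_max R R^o (cst 0)
  (fun t => 1 - 3 * `|2 ^+ n.1.+1 * (t - n.2%:R) - 1|) t).
  exact: cvg_cst.
apply: cvgB; first exact: cvg_cst.
apply: cvgM; first exact: cvg_cst.
apply: cvg_norm; apply: cvgB; last exact: cvg_cst.
apply: cvgM; first exact: cvg_cst.
by apply: cvgB; [exact: cvg_id | exact: cvg_cst].
Qed.

Lemma hat_neq0 n t : hat n t != 0 ->
  2 / 3 < 2 ^+ n.1.+1 * (t - n.2%:R) < 4 / 3.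
Proof.
move=> hn; set u := _ ^+ _ * _.
have u1 : 0 < 1 - 3 * `|u - 1|.
  by rewrite ltNge; apply: contra hn => ?; apply/eqP; apply/max_idPl.
have : `|u - 1| < 1 / 3 by lra.
by rewrite ltr_norml => /andP[? ?]; apply/andP; split; lra.
Qed.

Lemma hat_neq0_itv n t : hat n t != 0 -> n.2%:R < t < n.2%:R + 1.
Proof.
move=> /hat_neq0; rewrite exprS; set w := _ ^+ _.
have w1 : 1 <= w by apply: exprn_ege1; rewrite ler1n.
by move=> /andP[h1 h2]; apply/andP; split; nra.
Qed.

Lemma hat_nat n k : hat n k%:R = 0.
Proof.
apply/eqP/negP => /negP /hat_neq0_itv.
by rewrite natr1 !ltr_nat ltnS; case: ltngtP.
Qed.

(** The column is the integer part of t.  Within a column, rescaling by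
    [2 ^+ n.1.+1] sends the open support of the hat n onto ]2/3, 4/3[, and a
    larger exponent moves every point of this interval past 4/3. *)
Lemma hat_disjoint n m t : hat n t != 0 -> hat m t != 0 -> n = m.
Proof.
wlog le_nm : n m / (n.1 <= m.1)%N => [H|] hn hm.
  by case: (leqP n.1 m.1) => [/H|/ltnW /H h]; [exact | exact/esym/h].
have nm2 : n.2 = m.2.
  have /andP[n1 n2] := hat_neq0_itv hn; have /andP[m1 m2] := hat_neq0_itv hm.
  have := lt_trans n1 m2; have := lt_trans m1 n2.
  rewrite !natr1 !ltr_nat !ltnS => ? ?.
  by apply/eqP; rewrite eqn_leq; apply/andP.
suff nm1 : n.1 = m.1 by move: n m nm1 nm2 {hn hm le_nm} => [? ?] [? ?] /= -> ->.
apply/eqP; rewrite eqn_leq le_nm /= leqNgt; apply/negP => lt_nm.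
have /andP[+ _] := hat_neq0 hn; have /andP[_] := hat_neq0 hm; rewrite nm2.
rewrite -(subnK lt_nm) -addSn exprD exprS; set s := t - _; set w := 2 ^+ n.1.+1.
have p1 : 1 <= 2 ^+ (m.1 - n.1.+1) :> R by apply: exprn_ege1; rewrite ler1n.
rewrite -!mulrA; set z := w * s; nra.
Qed.

(** At most one hat is nonzero at t, so the sum over all hats is the term of
    this index; the default value only serves points where every hat is 0. *)
Definition hat_index t : nat * nat := xget (0, 0)%N [set n | hat n t != 0].

Lemma hat_indexE n t : hat n t != 0 -> hat_index t = n.
Proof.
move=> hn; apply: (@hat_disjoint _ _ t) => //.
by apply: (@xgetPex _ _ [set n | hat n t != 0]); exists n.
Qed.

Definition glue y t : R := y (hat_index t) * hat (hat_index t) t.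

Lemma glueE y n t : hat n t != 0 -> glue y t = y n * hat n t.
Proof. by move=> /hat_indexE; rewrite /glue => ->. Qed.

Lemma glue_peak y n : glue y (peak n) = y n.
Proof. by rewrite (@glueE _ n) hat_peak ?mulr1 ?oner_eq0. Qed.

(** Below the abscissa k only the hats of the first k columns are met, and at
    most one of them at each point. *)
Lemma glue_le y (k : nat) (e : R) t :
  (forall i j, (j < k)%N -> `|y (i, j)| <= e) -> 0 <= e -> t <= k%:R ->
  `|glue y t| <= e.
Proof.
move=> ye e0 tk; rewrite /glue.
have [->|h] := eqVneq (hat (hat_index t) t) 0; first by rewrite mulr0 normr0.
rewrite normrM (ger0_norm (hat_ge0 _ _)).
rewrite (le_trans (ler_piMr _ (hat_le1 _ _)))//.
case: (hat_index t) h => i j /hat_neq0_itv/andP[/= jt _].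
by apply: ye; rewrite -(ltr_nat R) (lt_le_trans jt).
Qed.

(** Around a point in the open support of a hat, only this hat counts.  At any
    other point all hats vanish: near it, the hats with large coefficients are
    finitely many, hence small together by continuity, and the remaining ones
    are small everywhere. *)
Lemma glue_continuous y :
  (forall k, y (i, k) @[i --> \oo] --> 0) -> continuous (glue y).
Proof.
move=> y0; suff H (t : R) : glue y s @[s --> t] --> glue y t by exact: H.
have ch n : (fun s => y n * hat n s) @ t --> y n * hat n t.
  by apply: cvgM; [exact: cvg_cst | exact: hat_continuous].
have [[n hn]|hN] := pselect (exists n, hat n t != 0).
  have nh : \forall s \near t, hat n s != 0.
    exact: (cvgr_neq0 (hat n t) (@hat_continuous n t) hn).
  rewrite (glueE _ hn); apply: cvg_trans (ch n); apply: near_eq_cvg.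
  by near do [rewrite (@glueE y n)//].
have h0 n : hat n t = 0.
  by apply/eqP/negPn/negP => hn; apply: hN; exists n.
rewrite {2}/glue h0 mulr0; apply/cvgr0Pnorm_lt => e e0.
have [m tm] : exists m : nat, t < m%:R.
  exists (Num.bound `|t|).
  by rewrite (le_lt_trans (ler_norm _) (archi_boundP _)).
have small (k : nat) :
    \forall s \near t, forall i, `|y (i, k) * hat (i, k) s| < e.
  have [N _ yN] := (cvgr0Pnorm_lt _).1 (y0 k) _ e0.
  have : \forall s \near t,
      forall i : 'I_N, `|y (val i, k) * hat (val i, k) s| < e.
    apply: (@filter_forall _ 'I_N
      (fun i s => `|y (val i, k) * hat (val i, k) s| < e) (nbhs t) _) => i.
    by apply: (cvgr0_norm_lt _ _ _ e0); have := ch (val i, k); rewrite h0 mulr0.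
  apply: filterS => s Hs i; have [iN|Ni] := ltnP i N.
    exact: (Hs (Ordinal iN)).
  rewrite normrM (ger0_norm (hat_ge0 _ _)).
  by rewrite (le_lt_trans (ler_piMr _ (hat_le1 _ _)))// yN.
have : \forall s \near t,
    forall (k : 'I_m) i, `|y (i, val k) * hat (i, val k) s| < e.
  apply: (@filter_forall _ 'I_m
    (fun k s => forall i, `|y (i, val k) * hat (i, val k) s| < e)
    (nbhs t) _) => k.
  exact: small.
have : \forall s \near t, s < m%:R by exact: lt_nbhsl.
apply: filterS2 => s sm H; rewrite /glue.
have [->|h] := eqVneq (hat (hat_index s) s) 0; first by rewrite mulr0 normr0.
case: (hat_index s) h => i j /hat_neq0_itv/andP[/= js _].
have jm : (j < m)%N by rewrite -(ltr_nat R) (lt_trans js).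
exact: (H (Ordinal jm)).
Unshelve. all: by end_near.
Qed.

End Hats.

(** * Neighbourhoods in the space of continuous functions *)

Section CompactConvergence.
Context (R : realType).

Lemma cvg_initial {S : choiceType} {T : topologicalType} (h : S -> T)
    (F : set_system S) (s : S) : Filter F ->
  h @ F --> h s -> F --> (s : initial_topology h).
Proof.
move=> FF hF U [B [[C oC <-] Cs] CU]; rewrite nbhs_filterE.
by apply: filterS CU _; apply: hF; exact: open_nbhs_nbhs.
Qed.

Lemma CR_cvg (F : set_system (CR R)) (f : CR R) : Filter F ->
  (forall (m : nat) (e : R), 0 < e ->
    F [set g : CR R | forall t : R, `|t| <= m%:R -> `|f t - g t| < e]) ->
  F --> f.
Proof.
move=> FF H; apply: cvg_initial; apply/fam_cvgP => K cK.
move=> U /uniform_nbhs[E [entE EU]].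
have [e e0 eE] := entE.
have [M [_ KM]] := compact_bounded cK.
pose m := Num.bound `|M + 1|.
rewrite nbhs_filterE /fmap /=.
apply: filterS (H m e e0) => g Hg; apply: EU => t Kt; apply: eE => /=.
have M1 : M < M + 1 by rewrite ltrDl.
apply: Hg; apply: le_trans (KM _ M1 _ Kt) _.
by rewrite (le_trans (ler_norm _))// ltW// archi_boundP.
Qed.

Lemma CR_nbhs_ball (f : CR R) (m : nat) (e : R) : 0 < e ->
  nbhs f [set g : CR R | forall t : R, `|t| <= m%:R -> `|f t - g t| < e].
Proof.
move=> e0.
have K : compact `[- m%:R : R, m%:R] by exact: segment_compact.
have entE : entourage [set p : R * R | `|p.1 - p.2| < e] by exists e.
have := fam_nbhs (f : {family compact, R -> R}) entE K.
move=> /(@initial_continuous (CR R) {family compact, R -> R} (@CR_val R) f).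
rewrite nbhs_filterE /fmap /=.
apply: filterS => g Hg t; rewrite ler_norml => tm.
by apply: Hg; rewrite /= in_itv.
Qed.

(** The balls of radius 1/(n+1) over [-n, n] form a filter which converges to f,
    so each neighbourhood of f contains one of them. *)
Lemma CR_nbhsP (f : CR R) (U : set (CR R)) : nbhs f U ->
  exists (m : nat) (e : R), 0 < e /\
    [set g : CR R | forall t : R, `|t| <= m%:R -> `|f t - g t| < e] `<=` U.
Proof.
pose B (n : nat) := [set g : CR R |
  forall t : R, `|t| <= n%:R -> `|f t - g t| < n.+1%:R^-1].
have Bmono i j : (i <= j)%N -> B j `<=` B i.
  move=> ij g Hg t ti.
  rewrite (lt_le_trans (Hg _ (le_trans ti _))) ?ler_nat//.
  by rewrite lef_pV2 ?posrE ?ltr0n// ler_nat.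
have FF : Filter (filter_from setT B).
  apply: filter_fromT_filter; first by exists 0%N.
  move=> i j; exists (maxn i j) => g Bg.
  by split; apply: Bmono Bg; rewrite ?leq_maxl ?leq_maxr.
have : filter_from setT B --> f.
  apply: CR_cvg => m e e0; pose n := maxn m (Num.bound `|e^-1|).
  exists n => // g Bg t tm.
  rewrite (lt_le_trans (Bg _ (le_trans tm _))) ?ler_nat ?leq_maxl//.
  rewrite -[leRHS]invrK lef_pV2 ?posrE ?ltr0n ?invr_gt0//.
  rewrite (le_trans (ler_norm _))// ltW//.
  by rewrite (lt_le_trans (archi_boundP _))// ler_nat leqW// leq_maxr.
by move=> H /H [n _ BU]; exists n, n.+1%:R^-1; split.
Qed.

Lemma CR_eval_continuous (t : R) : continuous (fun f : CR R => f t).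
Proof.
move=> f; apply/(@cvgrPdist_lt _ R^o _ _ (nbhs_filter f)) => e e0.
apply: (@filterS _ (nbhs f) (nbhs_filter f) _ _ _
  (CR_nbhs_ball f (Num.bound `|t|) e0)) => g.
by apply; rewrite ltW// archi_boundP.
Qed.

End CompactConvergence.

(** * The closed copy of a Koethe space *)

Section Embedding.
Context (R : realType) (A : kothe R).

Definition weighted (x : nat -> R) (n : nat * nat) : R := x n.1 * val A n.

Lemma glue_weighted_continuous (x : lambda0 A) :
  continuous (glue (weighted (val x))).
Proof. by apply: glue_continuous => k; have /set_mem/(_ k I) := valP x. Qed.

Definition embed (x : lambda0 A) : CR R :=
  CR_Sub (asboolT (@glue_weighted_continuous x)).

(** Column 0 suffices to read a sequence off from its sum of hats. *)
Definition coords (f : R -> R) (i : nat) : R :=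
  f (peak R (i, 0%N)) / val A (i, 0%N).

(** The range of [embed], described without mentioning sequences: the condition
    at t only involves the values of f at t and at one peak, which makes the set
    visibly closed. *)
Definition glued : set (CR R) :=
  [set f : CR R | forall t, f t = glue (weighted (coords f)) t].

Lemma glued_submod : submod_closed (mem glued).
Proof.
split => [|c f g]; rewrite !in_setE.
  by move=> t; rewrite /glue /weighted /coords !mul0r.
move=> hf hg t.
transitivity (c * f t + g t); first by [].
rewrite hf hg /glue /weighted /coords.
rewrite -[(c *: f + g) _]/(c * f _ + g _); ring.
Qed.

Lemma glued_closed : closed glued.
Proof.
have -> : glued = \bigcap_(t in [set: R])
    ((fun f : CR R => f t - glue (weighted (coords f)) t) @^-1` [set 0]).
  apply/seteqP; split => f hf t; first by move=> _; rewrite /= -hf subrr.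
  by apply/eqP; rewrite -subr_eq0; apply/eqP; exact: hf.
apply: closed_bigI => t _.
apply: closed_comp; last exact: closed_eq.
move=> f _; have FF := nbhs_filter f.
apply: (cvgB (FF := FF)); first exact: CR_eval_continuous.
do 3 (apply: (cvgM (FF := FF)); last exact: (@cvg_cst _ _ _ _ FF)).
exact: CR_eval_continuous.
Qed.

Definition glued_SF : SF R :=
  SigSub (mem_set (conj glued_closed glued_submod)).

Lemma glued_peak (f : CR R) (n : nat * nat) : glued f ->
  f (peak R n) = coords f n.1 * val A n.
Proof. by move=> ->; rewrite glue_peak. Qed.

Lemma peak_cvg (k : nat) : (fun i => peak R (i, k)) @ \oo --> (k%:R : R).
Proof.
rewrite -[X in _ --> X]addr0 /peak /=.
apply: cvgD; first exact: cvg_cst.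
rewrite [X in X @ _ --> _](_ : _ = geometric 2^-1 2^-1).
  by apply: cvg_geometric; rewrite gtr0_norm ?invr_gt0// invf_lt1// ltr1n.
by apply/funext => i /=; rewrite -exprVn exprS.
Qed.

(** The coefficients [coords f i * val A (i, k)] are the values of f at the
    peaks of column k, which converge to k, where f vanishes. *)
Lemma coords_lambda0 (f : CR R) : glued f -> lambda0_pred A (coords f).
Proof.
move=> hf; apply/mem_set => k _; rewrite /lambda_set /=.
under eq_fun => i do rewrite -(@glued_peak _ (i, k))//.
have -> : 0 = f k%:R :> R by rewrite hf /glue hat_nat mulr0.
apply: continuous_cvg; [exact: cts_fun | exact: peak_cvg].
Qed.

Lemma embed_coords (f : CR R) (hf : glued f) :
  embed (exist _ (coords f) (coords_lambda0 hf)) = f.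
Proof. by apply/val_inj/funext => t; exact/esym/hf. Qed.

Lemma coords_embed (x : lambda0 A) : coords (embed x) = val x.
Proof.
apply/funext => i; rewrite /coords -[embed x _]/(glue (weighted (val x)) _).
rewrite glue_peak /weighted mulfK//.
by rewrite gt_eqF// kothe_gt0.
Qed.

Lemma embed_glued (x : lambda0 A) : glued (embed x).
Proof. by move=> t; rewrite coords_embed. Qed.

End Embedding.

(** * Neighbourhoods in a Koethe space *)

Section Lambda0Topology.
Context (R : realType) (A : kothe R).

Lemma kothe_le i j k : (j <= k)%N -> val A (i, j) <= val A (i, k).
Proof.
move=> /subnK <-; elim: (k - j)%N => [|l IH]; first by rewrite add0n.
rewrite (le_trans IH)// addSn.
by have /set_mem/(_ i (l + j)%N)/andP[] := valP A.
Qed.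

Lemma weighted_le (x : nat -> R) i j k : (j <= k)%N ->
  `|weighted A x (i, j)| <= `|weighted A x (i, k)|.
Proof.
move=> jk; rewrite /weighted !normrM ler_wpM2l//.
by rewrite !gtr0_norm ?kothe_gt0// kothe_le.
Qed.

Lemma lambda0_cvg (F : set_system (lambda0 A)) (x : lambda0 A) : Filter F ->
  (forall k (e : R), 0 < e -> F [set y : lambda0 A |
    forall i, `|weighted A (val x - val y) (i, k)| <= e]) ->
  F --> x.
Proof.
move=> FF H; apply: cvg_initial; apply/cvg_sup => k; apply: cvg_initial.
apply/cvgrPdist_le => e e0.
suff: F [set y | `|lambda0_diag x k - lambda0_diag y k| <= e] by [].
apply: filterS (H k e e0) => y Hy.
exact: (@lambda_norm_le R A k (lambda0_diag x k - lambda0_diag y k)).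
Qed.

Lemma lambda0_nbhs_ball (x : lambda0 A) k (e : R) : 0 < e ->
  nbhs x [set y : lambda0 A |
    forall i, `|weighted A (val x - val y) (i, k)| < e].
Proof.
move=> e0.
have cp : (fun y => lambda0_diag y k) @ nbhs x --> lambda0_diag x k.
  apply: (@continuous_comp _ _ _ (@lambda0_diag R A) (fun z => z k)).
    exact: initial_continuous.
  exact: proj_continuous.
have := (cvgrPdist_lt (FF := nbhs_filter x) _ _).1 cp e e0.
apply: filterS => y Hy i; apply: le_lt_trans Hy.
exact: (lambda_norm_ub (lambda0_diag x k - lambda0_diag y k) i).
Qed.

End Lambda0Topology.

(** * The isomorphism *)

Section Isomorphism.
Context (R : realType) (A : kothe R).

Lemma embed_sub_le (x y : lambda0 A) (m : nat) (e : R) t :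
  (forall i, `|weighted A (val x - val y) (i, m)| <= e) -> t <= m%:R ->
  `|embed x t - embed y t| <= e.
Proof.
move=> xy tm.
have -> : embed x t - embed y t = glue (weighted A (val x - val y)) t.
  by rewrite /glue /weighted -!mulrBl.
apply: (@glue_le _ _ m) => // [i j jm|].
  by rewrite (le_trans (weighted_le _ _ _ (ltnW jm))).
by rewrite (le_trans _ (xy 0%N)).
Qed.

Definition to_lambda0 (f : SF_type (glued_SF A)) : lambda0 A :=
  exist _ (coords A (val f)) (coords_lambda0 (set_mem (valP f))).

Definition of_lambda0 (x : lambda0 A) : SF_type (glued_SF A) :=
  exist _ (embed x) (mem_set (embed_glued x)).

Lemma to_lambda0_linear : linear to_lambda0.
Proof.
move=> c f g; apply/val_inj/funext => i.
rewrite /= /coords.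
transitivity ((c * val f (peak R (i, 0%N)) + val g (peak R (i, 0%N))) /
  val A (i, 0%N)); first by [].
by rewrite mulrDl -mulrA.
Qed.

HB.instance Definition _ := GRing.isLinear.Build R _ _ _ to_lambda0
  to_lambda0_linear.

Lemma to_lambda0K : cancel to_lambda0 of_lambda0.
Proof. by move=> f; apply/val_inj; exact: embed_coords. Qed.

Lemma of_lambda0K : cancel of_lambda0 to_lambda0.
Proof. by move=> x; apply/val_inj; exact: coords_embed. Qed.

Lemma peak_le (n : nat * nat) : `|peak R n| <= n.2.+1%:R.
Proof.
rewrite /peak ger0_norm ?addr_ge0 ?invr_ge0 ?exprn_ge0//.
by rewrite -[n.2.+1%:R]natr1 lerD2l invf_le1 ?exprn_gt0// exprn_ege1// ler1n.
Qed.

Lemma to_lambda0_continuous : continuous to_lambda0.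
Proof.
move=> f; have FF := nbhs_filter f.
apply: lambda0_cvg => k e e0.
have vc : val @ nbhs f --> val f := @initial_continuous _ (CR R) val f.
apply: (@filterS _ (nbhs f) FF _ _ _ (vc _ (CR_nbhs_ball (val f) k.+1 e0))).
move=> g Hg i.
rewrite /weighted /= mulrBl.
rewrite -!(@glued_peak _ _ _ (i, k)).
- exact/ltW/Hg/peak_le.
- exact: set_mem (valP g).
- exact: set_mem (valP f).
Qed.

Lemma of_lambda0_continuous : continuous of_lambda0.
Proof.
move=> x; have FF := nbhs_filter x.
apply: cvg_initial; apply: CR_cvg => m e e0.
have e2 : 0 < e / 2 by rewrite divr_gt0.
apply: filterS (lambda0_nbhs_ball x m e2) => y Hy t tm.
apply: (@le_lt_trans _ _ (e / 2)); last first.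
  by rewrite ltr_pdivrMr// ltr_pMr// ltr1n.
apply: (@embed_sub_le x y m) => [i|]; first exact/ltW/Hy.
exact: le_trans (ler_norm _) tm.
Qed.

Lemma glued_isomorphic : isomorphic (SF_type (glued_SF A)) (lambda0 A).
Proof.
exists to_lambda0, of_lambda0; split.
- exact: to_lambda0K.
- exact: of_lambda0K.
- exact: to_lambda0_continuous.
- exact: of_lambda0_continuous.
Qed.

End Isomorphism.

(** * Borel dependence on the matrix *)

Section Measurability.
Context (R : realType).

(** The entries are discrete and the topology is that of the product, so
    finitely many entries can be prescribed in a neighbourhood. *)
Lemma Kstar_nbhs_eq (A : Kstar R) (N m : nat) :
  nbhs A [set B : Kstar R | forall i k, (i < N)%N -> (k < m)%N ->
    val B (i, k) = val A (i, k)].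
Proof.
have FF := nbhs_filter A.
have eqn (n : nat * nat) : nbhs A [set B : Kstar R | val B n = val A n].
  have cv : (fun B : Kstar R => val B n) @ nbhs A --> (val A n : nat).
    apply: (@continuous_comp _ _ _ (val : Kstar R -> {ptws nat * nat -> nat})
      (fun a => a n)).
      exact: initial_continuous.
    exact: (@proj_continuous _ (fun=> nat)).
  apply: (cv [set val A n]); apply: open_nbhs_nbhs.
  by split; first exact: discrete_open.
have := @filter_forall _ ('I_N * 'I_m)%type (fun p (B : Kstar R) =>
  val B (val p.1, val p.2) = val A (val p.1, val p.2)) (nbhs A) FF
  (fun p => eqn _).
apply: filterS => B HB i k iN km.
exact: (HB (Ordinal iN, Ordinal km)).
Qed.

Definition truncate (N : nat) (x : nat -> R) (i : nat) : R :=
  if (i < N)%N then x i else 0.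

Lemma truncate_lambda0 (A : kothe R) N x : lambda0_pred A (truncate N x).
Proof.
apply/mem_set => k _; apply: cvg_near_cst; exists N => // i /= Ni.
by rewrite /truncate ltnNge Ni mul0r.
Qed.

(** A function of the copy of A is approximated, uniformly on a compact set, by
    a function that depends on finitely many entries of A only. *)
Lemma glued_meets_open (U : set (CR R)) : open U ->
  open [set A : Kstar R | glued (kothe_of A) `&` U !=set0].
Proof.
move=> oU; rewrite openE => A [f [fA Uf]].
have [m [e [e0 BU]]] := CR_nbhsP (open_nbhs_nbhs (conj oU Uf)).
pose x := coords (kothe_of A) f.
(* Column m bounds the columns met on [-m, m], by monotonicity. *)
have [N _ xN] : \forall i \near \oo, `|weighted (kothe_of A) x (i, m)| < e / 2.
  have /set_mem/(_ m I) := coords_lambda0 fA.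
  by move=> /cvgr0Pnorm_lt; apply; rewrite divr_gt0.
apply: filterS (Kstar_nbhs_eq A N m) => B AB.
pose y : lambda0 (kothe_of B) :=
  exist (lambda0_pred (kothe_of B)) _ (truncate_lambda0 (kothe_of B) N x).
exists (embed y).
split; first exact: embed_glued.
apply: BU => t tm; rewrite fA.
apply: (@le_lt_trans _ _ (e / 2)); last first.
  by rewrite ltr_pdivrMr// ltr_pMr// ltr1n.
rewrite [_ - _](_ : _ = glue (fun n => weighted (kothe_of A) x n -
    weighted (kothe_of B) (truncate N x) n) t); last by rewrite /glue -mulrBl.
apply: (@glue_le _ _ m) => [i k km| |].
- rewrite /weighted /truncate /=; case: ltnP => [iN|Ni].
    by rewrite AB// subrr normr0 divr_ge0// ltW.
  rewrite mul0r subr0; apply: le_trans (ltW (xN i Ni)).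
  exact: (@weighted_le R (kothe_of A) x i k m (ltnW km)).
- by rewrite divr_ge0// ltW.
- exact: le_trans (ler_norm _) tm.
Qed.

End Measurability.

Theorem lemma4p29 (R : realType) :
  exists phi : Kstar R -> SF R,
    measurable_fun [set: Kstar_borel R] (phi : Kstar_borel R -> SF_effros R) /\
    forall A : Kstar R, isomorphic (SF_type (phi A)) (lambda0 (kothe_of A)).
Proof.
exists (fun A => glued_SF (kothe_of A)); split; last first.
  by move=> A; exact: glued_isomorphic.
apply: (@measurability _ _ (Kstar_borel R) (SF_effros R) _ _
  (@effros_generators R)); first by [].
move=> _ [_ [U oU <-] <-]; rewrite setTI.
by apply: sub_sigma_algebra; exact: glued_meets_open.
Qed.
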